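(* The double spider $\mathrm{Sp}(1,1;1,2)$ is the unique smallest $\operatorname{IR}$-tree of diameter $4$: $\mathrm{Sp}(1,1;1,2)$ (which has $7$ vertices and diameter $4$) is an $\operatorname{IR}$-graph, and every tree $T$ of diameter $4$ with $|V(T)|\leq 7$ that is an $\operatorname{IR}$-graph is isomorphic to $\mathrm{Sp}(1,1;1,2)$.
   Context: All graphs are finite and simple. For $G=(V,E)$, $D\subseteq V$, $v\in D$: $\operatorname{PN}(v,D)=N[v]-N[D-\{v\}]$ (closed neighbourhoods). $D$ is irredundant if $\operatorname{PN}(v,D)\neq\varnothing$ for all $v\in D$; $\operatorname{IR}(G)$ is the maximum size of an irredundant set; an $\operatorname{IR}(G)$-set is an irredundant set of that size. $G(\operatorname{IR})$ has the $\operatorname{IR}(G)$-sets as vertices, with $D\sim D'$ iff there exist $u\in D$, $v\in D'$ with $uv\in E(G)$ and $D'=(D-\{u\})\cup\{v\}$. A graph $H$ is an $\operatorname{IR}$-graph if $H\cong G(\operatorname{IR})$ for some graph $G$; an $\operatorname{IR}$-tree is a tree that is an $\operatorname{IR}$-graph. The double spider $\mathrm{Sp}(1,1;1,2)$ is the tree obtained from the double star $S(2,2)$ (two copies of $K_{1,2}$ with their centres joined by an edge) by subdividing one leaf edge once: explicitly, vertices $u,u_1,u_2,v,v_1,w,v_2$ with edges $uu_1,uu_2,uv,vv_1,vw,wv_2$. *)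

(* Defs.v *)
From mathcomp Require Import all_boot.
Set Implicit Arguments. Unset Strict Implicit. Unset Printing Implicit Defensive.

Section Graphs.
Variable V : finType.
Variable adj : rel V.

Definition simple_graph : Prop := symmetric adj /\ irreflexive adj.

Definition cnbh (v : V) : {set V} := [set u | (u == v) || adj v u].
Definition cnbhS (S : {set V}) : {set V} := \bigcup_(x in S) cnbh x.

Definition PN (v : V) (D : {set V}) : {set V} := cnbh v :\: cnbhS (D :\ v).

Definition irredundant (D : {set V}) : bool := [forall v in D, PN v D != set0].

Definition IRnum : nat := \max_(D : {set V} | irredundant D) #|D|.

Definition IRset (D : {set V}) : bool := irredundant D && (#|D| == IRnum).

Definition IRadj (D D' : {set V}) : Prop :=
  exists u v, [/\ u \in D, v \in D', adj u v & D' = (D :\ u) :|: [set v]].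

Definition has_cycle : Prop :=
  exists (x : V) (p : seq V),
    [/\ path adj x p, uniq (x :: p), 2 <= size p & adj (last x p) x].

Definition connected_graph : Prop := forall x y : V, connect adj x y.

Definition is_tree : Prop := simple_graph /\ connected_graph /\ ~ has_cycle.

Definition dist_le (x y : V) (n : nat) : Prop :=
  exists p : seq V, [/\ path adj x p, last x p = y & size p <= n].

Definition has_diameter (d : nat) : Prop :=
  (forall x y, dist_le x y d) /\ (exists x y, forall n, dist_le x y n -> d <= n).

End Graphs.

Definition isomorphic (T T' : finType) (a : rel T) (a' : rel T') : Prop :=
  exists f : T -> T', bijective f /\ forall x y, a x y = a' (f x) (f y).

Definition IR_graph (T : finType) (h : rel T) : Prop :=
  exists (V : finType) (adj : rel V), simple_graph adj /\
    exists f : T -> {set V},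
      [/\ injective f,
          (forall D, IRset adj D <-> exists x, f x = D) &
          (forall x y, h x y <-> IRadj adj (f x) (f y))].

(* the double spider Sp(1,1;1,2): u=0, u1=1, u2=2, v=3, v1=4, w=5, v2=6;
   edges uu1, uu2, uv, vv1, vw, wv2 *)
Definition sp_edges : seq (nat * nat) :=
  [:: (0, 1); (0, 2); (0, 3); (3, 4); (3, 5); (5, 6)].

Definition sp_adj : rel 'I_7 := fun x y =>
  ((nat_of_ord x, nat_of_ord y) \in sp_edges) || ((nat_of_ord y, nat_of_ord x) \in sp_edges).

(* Main.v *)
Require Import Defs.
From mathcomp Require Import all_boot ring.
Set Implicit Arguments. Unset Strict Implicit. Unset Printing Implicit Defensive.

(** If [g v] is a private neighbour of [v] in the irredundant set [D] for every
    [v \in D], then [g @: D] is again irredundant, with [v] private to [g v]: the flip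
    of [D].  In an IR-tree, the absence of 4-cycles forces a dependent IR-set to have
    at least three non-isolated vertices, so that its distance to a flip is at least 3;
    the absence of triangles and 4-cycles also forces an independent IR-set to have at
    most one independent neighbour.
    In an IR-tree of diameter 4 the centre [C] is therefore independent and has a
    dependent neighbour [A1 = C - p + a].  The path from [A1] to its flip is
    [A1], [C], [B = C - b + b'], [B1 = B - c + c'], which determines the graph induced
    by [a, b, c, p, b', c']: its edges are [ap, bb', cc', ab, ac, pc', b'c'], and the rest
    of [C] is isolated from it.  Hence [C - c + a] and [B - p + c'] are IR-sets as well, and
    the tree contains the double star S(2,2) with centres [C] and [B].  With at
    most 7 vertices there is room for a single further vertex, which must be
    adjacent to a leaf at [C], as [C] is the centre. *)

(** * Irredundant sets *)

Definition swap (V : finType) (D : {set V}) (u v : V) : {set V} :=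
  (D :\ u) :|: [set v].

Definition indep (V : finType) (adj : rel V) (D : {set V}) : Prop :=
  {in D &, forall x y, ~~ adj x y}.

Section IRsets.
Variables (V : finType) (adj : rel V).
Hypotheses (adjC : symmetric adj) (adjI : irreflexive adj).
Implicit Types (u v w x y z : V) (D X : {set V}).

Lemma in_swap D u v z : (z \in swap D u v) = (z != u) && (z \in D) || (z == v).
Proof. by rewrite !inE. Qed.

Lemma card_swap D u v : u \in D -> v \notin D -> #|swap D u v| = #|D|.
Proof.
by move=> uD vD; rewrite /swap setUC cardsU1 !inE (negPf vD) andbF (cardsD1 u D) uD.
Qed.

Lemma PNP v D w :
  reflect ((w = v \/ adj v w) /\ {in D, forall u, u != v -> w != u /\ ~~ adj u w})
          (w \in PN adj v D).
Proof.
rewrite /PN inE [w \in cnbh _ _]inE; apply: (iffP andP) => [[wS wv] | [wv wS]]; split.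
- by case/orP: wv => [/eqP|]; [left | right].
- move=> u uD uv; apply/andP; rewrite -negb_or; apply: contra wS => wu.
  by apply/bigcupP; exists u; rewrite !inE ?uv ?uD.
- apply/bigcupP => -[u]; rewrite !inE => /andP[uv uD].
  by have [/negPf-> /negPf->] := wS u uD uv.
- by case: wv => [->|->]; rewrite ?eqxx ?orbT.
Qed.

Lemma irredundantP D :
  reflect {in D, forall v, exists w, w \in PN adj v D} (irredundant adj D).
Proof.
apply: (iffP forall_inP) => irrD v vD; first exact/set0Pn/irrD.
exact/set0Pn/irrD.
Qed.

Lemma PN_isolated D v : v \in D -> {in D, forall u, ~~ adj u v} -> v \in PN adj v D.
Proof.
move=> vD iso; apply/PNP; split=> [|u uD uv]; first by left.
by rewrite eq_sym; split; last exact: iso.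
Qed.

Lemma indep_irredundant D : indep adj D -> irredundant adj D.
Proof.
by move=> ind; apply/irredundantP=> v vD; exists v; apply: PN_isolated => // u uD; apply: ind.
Qed.

(** Makes every choice of private neighbours injective, so that a flip keeps the size of the set. *)
Lemma PN_inj D u v w : u \in D -> v \in D -> w \in PN adj u D -> w \in PN adj v D -> u = v.
Proof.
move=> uD vD /PNP[_ wu] /PNP[wv _]; apply/eqP; apply: contraT => uv.
have [wv' nvw] := wu v vD (etrans (congr1 negb (eq_sym v u)) uv).
by case: wv => [wv|vw]; [rewrite wv eqxx in wv' | rewrite vw in nvw].
Qed.

(* The relation [w \in PN v D] is symmetric in the pair (v, w): [v] witnesses the
   irredundance of [g @: D] at [g v]. *)
Lemma flip_irredundant D (g : V -> V) :
  {in D, forall v, g v \in PN adj v D} -> irredundant adj (g @: D) /\ #|g @: D| = #|D|.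
Proof.
move=> gP; split; last first.
  by apply: card_in_imset => u v uD vD guv; apply: (PN_inj uD vD (gP u uD)); rewrite guv gP.
apply/irredundantP=> _ /imsetP[v vD ->]; exists v; apply/PNP; split.
  by case/PNP: (gP v vD) => -[->|vg] _; [left | right; rewrite adjC].
move=> _ /imsetP[u uD ->] guv; have uv : v != u by apply: contraNneq guv => ->.
by case/PNP: (gP u uD) => _ /(_ v vD uv)[]; rewrite eq_sym adjC.
Qed.

Lemma IRset_max D X : IRset adj D -> irredundant adj X -> #|X| <= #|D|.
Proof. by case/andP=> _ /eqP-> irrX; rewrite /IRnum (bigmax_sup X). Qed.

Lemma IRset_eq_card D X : IRset adj D -> irredundant adj X -> #|X| = #|D| -> IRset adj X.
Proof. by case/andP=> _ /eqP cD irrX cX; rewrite /IRset irrX cX cD eqxx. Qed.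

Lemma IRadj_swap D u v : u \in D -> adj u v -> IRadj adj D (swap D u v).
Proof. by move=> uD uv; exists u, v; rewrite in_swap eqxx orbT. Qed.

(** Equal sizes make the added vertex new: otherwise [X] would be [D :\ u]. *)
Lemma IRadjE D X : IRset adj D -> IRset adj X -> IRadj adj D X ->
  exists u v, [/\ u \in D, v \notin D, adj u v & X = swap D u v].
Proof.
move=> /andP[_ /eqP cD] /andP[_ /eqP cX] [u [v [uD vX uv eX]]]; exists u, v; split => //.
apply/negP => vD; have := cardsD1 u D; rewrite uD cD -cX.
suff -> : D :\ u = X by move/eqP; rewrite add1n eqn_leq ltnn andbF.
rewrite eX; apply/setP=> z; rewrite !inE; case: (z =P v) => [->|]; rewrite ?orbF // vD orbT andbT.
by apply: contraTneq uv => ->; rewrite adjI.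
Qed.

(** * IR-sets in the absence of triangles and 4-cycles *)

Hypothesis noTri : forall X Y Z : {set V},
  IRset adj X -> IRset adj Y -> IRset adj Z ->
  IRadj adj X Y -> IRadj adj X Z -> IRadj adj Y Z -> False.
Hypothesis noSq : forall W X Y Z : {set V},
  IRset adj W -> IRset adj X -> IRset adj Y -> IRset adj Z ->
  IRadj adj W X -> IRadj adj X Y -> IRadj adj W Z -> IRadj adj Z Y ->
  W != Y -> X != Z -> False.

(** A vertex with a neighbour in [D] is not its own private neighbour, and any other vertex of [D]
    lies in its own closed neighbourhood; so [a'] is outside [D]. *)
Lemma PN_self_notin D a b a' : a \in D -> b \in D -> adj a b ->
  a' \in PN adj a D -> [/\ adj a a', a' \notin D, a' != a, a' != b & ~~ adj b a'].
Proof.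
move=> aD bD ab /PNP[ea PNa].
have ba : b != a by apply: contraTneq ab => ->; rewrite adjI.
have [a'b nba'] := PNa b bD ba.
have aa' : adj a a' by case: ea => // ea; rewrite ea adjC ab in nba'.
have a'a : a' != a by apply: contraTneq aa' => ->; rewrite adjI.
split=> //; apply/negP => a'D; have [] := PNa a' a'D a'a.
by rewrite eqxx.
Qed.

(** Otherwise [ab] is the only edge inside [D], and private neighbours [a'] of [a] and [b'] of [b]
    give a 4-cycle of IR-sets: [D], [D - a + a'], [D - a - b + a' + b'], [D - b + b']. *)
Lemma third_nonisolated D a b : IRset adj D -> a \in D -> b \in D -> adj a b ->
  exists c d, [/\ c \in D, d \in D, c != a, c != b & adj c d].
Proof.
move=> IRD aD bD ab; have irrD := andP IRD; case: irrD => /irredundantP irrD _.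
case: (boolP [exists c in D, [exists d in D, [&& c != a, c != b & adj c d]]]).
  by case/exists_inP=> c cD /exists_inP[d dD /and3P[]]; exists c, d.
rewrite negb_exists_in => /forall_inP iso'.
have iso c d : c \in D -> d \in D -> c != a -> c != b -> ~~ adj c d.
  move=> cD dD ca cb; have := iso' c cD.
  by rewrite negb_exists_in => /forall_inP/(_ d dD); rewrite ca cb.
have ba : adj b a by rewrite adjC.
have [a' a'P] := irrD a aD; have [b' b'P] := irrD b bD.
have [aa' a'D a'a a'b nba'] := PN_self_notin aD bD ab a'P.
have [bb' b'D b'b b'a nab'] := PN_self_notin bD aD ba b'P.
have nxa' x : x \in D -> x != a -> ~~ adj x a'.
  by case/PNP: a'P => _ PNa xD xa; case: (PNa x xD xa).
have nxb' x : x \in D -> x != b -> ~~ adj x b'.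
  by case/PNP: b'P => _ PNb xD xb; case: (PNb x xD xb).
have neq_ab : a != b by apply: contraTneq ab => ->; rewrite adjI.
have neq_a'b' : a' != b' by apply: contraNneq nba' => ->.
pose Da := swap D a a'; pose Db := swap D b b'; pose Dab := swap Da b b'.
have indDa : indep adj Da.
  move=> x y; rewrite !in_swap.
  case/orP=> [/andP[xa xD]|/eqP->] /orP[/andP[ya yD]|/eqP->].
  - case: (eqVneq x b) => [->|xb]; last exact: iso.
    case: (eqVneq y b) => [->|yb]; first by rewrite adjI.
    by rewrite adjC; apply: iso.
  - exact: nxa'.
  - by rewrite adjC; apply: nxa'.
  - by rewrite adjI.
have indDb : indep adj Db.
  move=> x y; rewrite !in_swap.
  case/orP=> [/andP[xb xD]|/eqP->] /orP[/andP[yb yD]|/eqP->].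
  - case: (eqVneq x a) => [->|xa]; last exact: iso.
    case: (eqVneq y a) => [->|ya]; first by rewrite adjI.
    by rewrite adjC; apply: iso.
  - exact: nxb'.
  - by rewrite adjC; apply: nxb'.
  - by rewrite adjI.
have bDa : b \in Da by rewrite in_swap eq_sym neq_ab bD.
have aDb : a \in Db by rewrite in_swap neq_ab aD.
have b'Da : b' \notin Da by rewrite in_swap b'a (negPf b'D) eq_sym.
have eDab : Dab = swap Db a a'.
  apply/setP=> z; rewrite !in_swap.
  case: (eqVneq z a') => [->|_]; first by rewrite a'b !orbT.
  case: (eqVneq z b') => [->|_]; first by rewrite b'a !orbT.
  by rewrite !orbF andbCA.
(* [a'b'] may be an edge inside [Dab], so [a'] and [b'] get the private neighbours [a] and [b];
   every other vertex is isolated. *)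
have irrDab : irredundant adj Dab.
  apply/irredundantP=> v; rewrite !in_swap.
  case: (eqVneq v b') => [-> _|vb'].
    exists b; apply/PNP; split; first by right; rewrite adjC.
    move=> u; rewrite !in_swap => uD ub'; move: uD; rewrite (negPf ub') orbF.
    case/andP=> ub /orP[/andP[ua uD]|/eqP->]; first by rewrite eq_sym; split=> //; apply: iso.
    by rewrite eq_sym a'b adjC.
  rewrite orbF => /andP[vb]; case: (eqVneq v a') => [-> _|va'].
    exists a; apply/PNP; split; first by right; rewrite adjC.
    move=> u; rewrite !in_swap => uD ua'; move: uD; rewrite (negPf ua') orbF.
    case/orP=> [/andP[ub /andP[ua uD]]|/eqP->]; first by rewrite eq_sym; split=> //; apply: iso.
    by rewrite eq_sym b'a adjC.
  rewrite orbF => /andP[va vD]; exists v; apply: PN_isolated => [|u].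
    by rewrite !in_swap vb va vD.
  rewrite !in_swap adjC => /orP[/andP[_ /orP[/andP[_ uD]|/eqP->]]|/eqP->].
  - exact: iso.
  - exact: nxa'.
  - exact: nxb'.
have cDa : #|Da| = #|D| by apply: card_swap.
have cDb : #|Db| = #|D| by apply: card_swap.
have IRDa := IRset_eq_card IRD (indep_irredundant indDa) cDa.
have IRDb := IRset_eq_card IRD (indep_irredundant indDb) cDb.
have IRDab : IRset adj Dab by apply: IRset_eq_card IRDa irrDab (card_swap bDa b'Da).
exfalso; apply: (noSq IRD IRDa IRDab IRDb).
- exact: IRadj_swap.
- exact: IRadj_swap.
- exact: IRadj_swap.
- by rewrite eDab; apply: IRadj_swap.
- by apply: contraNneq a'D => ->; rewrite eDab in_swap eqxx orbT.
- by apply: contraTneq aDb => <-; rewrite in_swap eqxx eq_sym (negPf a'a).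
Qed.

(** Write [A = C - u + v] and [B = C - x + y]. If [u = x], either [vy] is an edge and [C], [A], [B]
    form a triangle, or [A + y] is independent and too large. If [u != x], performing both swaps
    gives an IR-set that completes a 4-cycle. *)
Lemma indep_neighbours_eq C A B :
  IRset adj C -> IRset adj A -> IRset adj B -> indep adj C -> indep adj A -> indep adj B ->
  IRadj adj C A -> IRadj adj C B -> A = B.
Proof.
move=> IRC IRA IRB indC indA indB CA CB; apply/eqP; apply: contraT => AB.
have [u [v [uC vC uv eA]]] := IRadjE IRC IRA CA.
have [x [y [xC yC xy eB]]] := IRadjE IRC IRB CB.
have vA : v \in A by rewrite eA in_swap eqxx orbT.
have yB : y \in B by rewrite eB in_swap eqxx orbT.
case: (eqVneq u x) => [ux|ux].
  have vy : v != y by apply: contraNneq AB => vy; rewrite eA eB ux vy.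
  case: (boolP (adj v y)) => [avy|navy].
    exfalso; apply: (noTri IRC IRA IRB CA CB); exists v, y; split=> //.
    rewrite eB eA -ux; apply/setP=> z; rewrite !inE.
    case: (eqVneq z v) => [->|_]; first by rewrite (negPf vC) andbF.
    by rewrite orbF.
  suff : #|y |: A| <= #|A|.
    rewrite cardsU1 eA in_swap (negPf yC) andbF eq_sym (negPf vy) /=.
    by rewrite ltnn.
  apply: IRset_max IRA _; apply: indep_irredundant => p q.
  have nyA z : z \in A -> ~~ adj y z.
    rewrite eA in_swap => /orP[/andP[zu zC]|/eqP->]; last by rewrite adjC.
    by apply: indB => //; rewrite eB in_swap -ux zu zC.
  rewrite !inE => /orP[/eqP->|pA] /orP[/eqP->|qA].
  - by rewrite adjI.
  - exact: nyA.
  - by rewrite adjC nyA.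
  - exact: indA.
have xA : x \in A by rewrite eA in_swap eq_sym ux xC.
have uB : u \in B by rewrite eB in_swap ux uC.
have vy : v != y.
  by apply: contraTneq xy => <-; apply: indA.
have yA : y \notin A by rewrite eA in_swap (negPf yC) andbF eq_sym.
have yu : y != u by apply: contraNneq yC => ->.
have vx : v != x by apply: contraNneq vC => ->.
pose W := swap A x y.
have eW : W = swap B u v.
  rewrite /W eA eB; apply/setP=> z; rewrite !in_swap.
  case: (eqVneq z v) => [->|_]; first by rewrite vx !orbT.
  case: (eqVneq z y) => [->|_]; first by rewrite yu !orbT.
  by rewrite !orbF andbCA.
(* [vy] may be an edge inside [W]; the removed [u] and [x] are private to [v] and [y]. *)
have irrW : irredundant adj W.
  apply/irredundantP=> z; rewrite eW in_swap.
  case: (eqVneq z v) => [-> _|zv].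
    exists u; apply/PNP; split; first by right; rewrite adjC.
    move=> t; rewrite in_swap => /orP[/andP[tu tB] _|/eqP->]; last by rewrite eqxx.
    by rewrite eq_sym; split=> //; apply: indB.
  rewrite orbF => /andP[zu]; rewrite eB in_swap.
  case: (eqVneq z y) => [-> _|zy].
    exists x; apply/PNP; split; first by right; rewrite adjC.
    move=> t; rewrite -eB -eW /W in_swap => /orP[/andP[tx tA] _|/eqP->]; last by rewrite eqxx.
    by rewrite eq_sym; split=> //; apply: indA.
  rewrite orbF => /andP[zx zC].
  exists z; apply: PN_isolated => [|t].
    by rewrite !in_swap zu zx zC.
  have zA : z \in A by rewrite eA in_swap zu zC.
  have zB : z \in B by rewrite eB in_swap zx zC.
  rewrite -eB in_swap => /orP[/andP[_ tB]|/eqP->].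
    by apply: indB.
  exact: indA.
have IRW : IRset adj W by apply: IRset_eq_card IRA irrW (card_swap xA yA).
exfalso; apply: (noSq IRC IRA IRW IRB) => //.
- exact: IRadj_swap.
- by rewrite eW; apply: IRadj_swap.
- by apply: contraNneq vC => ->; rewrite eW in_swap eqxx orbT.
Qed.

(** Isolated vertices are kept as their own private neighbours; all others, at least three by
    [third_nonisolated], leave [D]. As a swap removes one vertex, the flip is at distance at least 3
    from [D]. *)
Lemma dependent_flip D a b : IRset adj D -> a \in D -> b \in D -> adj a b ->
  exists D', [/\ IRset adj D', 2 < #|D :\: D'|,
    {in D, forall z, (z \in D') = [forall u in D, ~~ adj z u]} &
    {in D', forall z, exists2 v, v \in D & z \in PN adj v D}].
Proof.
move=> IRD aD bD ab; have [/irredundantP irrD _] := andP IRD.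
pose isol v := [forall u in D, ~~ adj v u].
(* The default of [odflt] is never reached on [D], which is irredundant. *)
pose g v := if isol v then v else odflt v [pick w in PN adj v D].
have gP : {in D, forall v, g v \in PN adj v D}.
  move=> v vD; rewrite /g; case: ifP => [/forall_inP iso|_].
    by apply: PN_isolated => // u uD; rewrite adjC iso.
  by case: pickP => // noPN; have [w] := irrD v vD; rewrite noPN.
have [irr' c'] := flip_irredundant gP.
have mem' : {in D, forall z, (z \in g @: D) = isol z}.
  move=> z zD; apply/imsetP/idP => [[v vD ez]|iso]; last by exists z; rewrite // /g iso.
  have := gP v vD; rewrite -ez => zPN.
  case: (eqVneq v z) => [evz|vz]; last first.
    by case/PNP: zPN => _ /(_ z zD); rewrite eq_sym vz eqxx => /(_ isT)[].
  apply/forall_inP => u uD; apply/negP => zu.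
  rewrite evz in zPN; have [_] := PN_self_notin zD uD zu zPN.
  by rewrite zD.
exists (g @: D); split => //; first exact: IRset_eq_card IRD irr' c'.
  have [c [d [cD dD ca cb cd]]] := third_nonisolated IRD aD bD ab.
  have neq_ab : a != b by apply: contraTneq ab => ->; rewrite adjI.
  have <- : #|[set c; a; b]| = 3 by rewrite -setUA cardsU1 cards2 !inE negb_or ca cb neq_ab.
  have dep x y : x \in D -> y \in D -> adj x y -> x \in D :\: g @: D.
    move=> xD yD xy; rewrite inE xD andbT mem' //.
    by apply/negP => /forall_inP/(_ y yD); rewrite xy.
  apply/subset_leq_card/subsetP => z; rewrite !inE => /orP[/orP[]|] /eqP->.
  - by have := dep c d cD dD cd; rewrite !inE.
  - by have := dep a b aD bD ab; rewrite !inE.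
  - by have := dep b a bD aD; rewrite !inE adjC; apply.
by move=> z /imsetP[v vD ->]; exists v; rewrite ?gP.
Qed.

Lemma IRadj_sym D X : IRset adj D -> IRset adj X -> IRadj adj D X -> IRadj adj X D.
Proof.
move=> IRD IRX DX; have [u [v [uD vD uv eX]]] := IRadjE IRD IRX DX.
exists v, u; rewrite uD eX in_swap eqxx orbT adjC uv; split=> //.
rewrite -/(swap (swap D u v) v u); apply/setP=> z; rewrite !in_swap.
case: (eqVneq z u) => [->|_]; first by rewrite uD orbT.
by case: (eqVneq z v) => [->|_]; rewrite ?(negPf vD) //= !orbF.
Qed.

(** * The double star around the centre *)

Lemma indep_or_edge D :
  indep adj D \/ exists a b, [/\ a \in D, b \in D & adj a b].
Proof.
case: (boolP [forall x in D, [forall y in D, ~~ adj x y]]) => [/forall_inP ind|].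
  by left=> x y xD yD; have /forall_inP := ind x xD; apply.
rewrite negb_forall_in => /exists_inP[x xD]; rewrite negb_forall_in => /exists_inP[y yD].
by rewrite negbK; right; exists x, y.
Qed.

(** Serves for [C - c + a] and [B - p + c']. As [D] is independent, [c] is private to [a]; among the
    other vertices only [p] and [b] can be adjacent to [a], so only these need private neighbours
    supplied. *)
Lemma swap_irredundant D p b c a p' b' :
  indep adj D -> p \in D -> b \in D -> c \in D -> adj a c -> 
  (forall z, z \in D -> z != p -> z != b -> z != c -> ~~ adj a z) ->
  p' \in PN adj p (swap D c a) -> b' \in PN adj b (swap D c a) ->
  irredundant adj (swap D c a).
Proof.
move=> ind pD bD cD ac nza p'P b'P; apply/irredundantP => v.
case: (eqVneq v p) => [->|vp]; first by exists p'.
case: (eqVneq v b) => [->|vb]; first by exists b'.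
rewrite in_swap; case: (eqVneq v a) => [-> _|va].
  exists c; apply/PNP; split; first by right.
  move=> u; rewrite in_swap => /orP[/andP[uc uD] _|/eqP->]; last by rewrite eqxx.
  by rewrite eq_sym; split=> //; apply: ind.
rewrite orbF => /andP[vc vD]; exists v; apply: PN_isolated; first by rewrite in_swap vc vD.
by move=> u; rewrite in_swap => /orP[/andP[_ uD]|/eqP->]; [apply: ind | apply: nza].
Qed.

(** The last hypothesis bounds the eccentricity of [C] by 2, while flips are at distance at least
    3. *)
Lemma double_star_of_centre C A0 B0 :
  IRset adj C -> IRset adj A0 -> IRset adj B0 -> IRadj adj C A0 -> IRadj adj C B0 -> A0 != B0 ->
  (forall X, IRset adj X -> [\/ X = C, IRadj adj C X |
     exists Y, [/\ IRset adj Y, IRadj adj C Y & IRadj adj Y X]]) ->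
  exists A1 A2 B B1 B2,
    [/\ all (IRset adj) [:: A1; A2; B; B1; B2], uniq [:: C; A1; A2; B; B1; B2],
        IRadj adj C A1 /\ IRadj adj C A2, IRadj adj C B & IRadj adj B B1 /\ IRadj adj B B2].
Proof.
move=> IRC IRA0 IRB0 CA0 CB0 neq0 ecc.
(* At most two swaps lead from [C] to any IR-set, whereas a flip of a dependent [C] misses three of
   its vertices. *)
have indC : indep adj C.
  move=> x y xC yC; apply/negP => xy.
  have [D [IRD]] := dependent_flip IRC xC yC xy; rewrite ltnNge => /negP big _ _; apply: big.
  case: (ecc D IRD) => [->|CD|[Y [IRY CY YD]]].
  - by rewrite setDv cards0.
  - have [u [v [_ _ _ ->]]] := IRadjE IRC IRD CD.
    apply: leq_trans (_ : #|[set u]| <= 2); last by rewrite cards1.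
    apply/subset_leq_card/subsetP => z; rewrite in_setD in_swap !inE.
    by rewrite negb_or negb_and negbK => /andP[/andP[/orP[->|/negPf->]]].
  - have [x1 [y1 [_ _ _ eD]]] := IRadjE IRY IRD YD.
    have [u [v [_ _ _ eY]]] := IRadjE IRC IRY CY.
    apply: leq_trans (_ : #|[set u; x1]| <= 2); last by rewrite cards2; case: eqP.
    apply/subset_leq_card/subsetP => z; rewrite eD eY in_setD !in_swap !inE.
    by case: (z == u); case: (z == x1) => //=; case: (z \in C) => //; rewrite ?andbF.
(* Distinct neighbours [A0] and [B0] of [C] are not both independent. *)
have [A [a0 [b0 [IRA CA a0A b0A ab0]]]] :
    exists A a0 b0, [/\ IRset adj A, IRadj adj C A, a0 \in A, b0 \in A & adj a0 b0].
  case: (indep_or_edge A0) => [indA0|[x [y [xA yA xy]]]]; last by exists A0, x, y.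
  case: (indep_or_edge B0) => [indB0|[x [y [xB yB xy]]]]; last by exists B0, x, y.
  case/eqP: neq0; exact: (indep_neighbours_eq IRC).
have [B1 [IRB1 big memB1 flipB1]] := dependent_flip IRA a0A b0A ab0.
have [p [a [pC aC pa eA]]] := IRadjE IRC IRA CA.
(* Were the flip [B1] equal or adjacent to [C], then [A] would lose at most two vertices on the way
   through [C]. *)
have [B [IRB CB BB1]] : exists B, [/\ IRset adj B, IRadj adj C B & IRadj adj B B1].
  case: (ecc B1 IRB1) => [eC|CD|//]; exfalso; move: big; rewrite ltnNge => /negP; apply.
    apply: leq_trans (_ : #|[set a]| <= 2); last by rewrite cards1.
    apply/subset_leq_card/subsetP => z; rewrite eC eA in_setD in_swap !inE.
    by case: (z \in C) => //=; rewrite andbF.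
  have [u [v [_ _ _ ->]]] := IRadjE IRC IRB1 CD.
  apply: leq_trans (_ : #|[set a; u]| <= 2); last by rewrite cards2; case: eqP.
  apply/subset_leq_card/subsetP => z; rewrite eA in_setD !in_swap !inE.
  by case: (z == u); case: (z == a) => //=; case: (z \in C); rewrite ?andbF ?orbT.
have [b [b' [bC b'C bb' eB]]] := IRadjE IRC IRB CB.
have [c [c' [cB c'B cc' eB1]]] := IRadjE IRB IRB1 BB1.
(* The three swaps from [A] to [B1] can remove only [a], [b] and [c] from [A]; since three vertices
   are lost, these are distinct and all lost. *)
have sABc : A :\: B1 \subset [set a; b; c].
  apply/subsetP => z; rewrite eA eB1 eB in_setD !in_swap !inE.
  by case: (z == a); case: (z == b); case: (z == c) => //=; case: (z \in C); rewrite ?andbF ?orbT.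
have card3 : 2 < #|[set a; b; c]| by apply: leq_trans big (subset_leq_card sABc).
have eAB1 : A :\: B1 = [set a; b; c].
  apply/eqP; rewrite eqEcard sABc; apply: leq_trans big.
  by rewrite setUC cardsU1 cards2; case: (_ \notin _); case: (_ != _).
have [ab ac bc] : [/\ a != b, a != c & b != c].
  split; apply: contraTneq card3 => ->; rewrite -leqNgt.
  - by rewrite setUid cards2; case: (_ != _).
  - by rewrite setUAC setUid cards2; case: (_ != _).
  - by rewrite -setUA setUid cards2; case: (_ != _).
have memAB1 z : z \in [set a; b; c] -> z \in A /\ z \notin B1.
  by rewrite -eAB1 in_setD => /andP[].
have [aA aB1] : a \in A /\ a \notin B1 by apply: memAB1; rewrite !inE eqxx.
have [bA bB1] : b \in A /\ b \notin B1 by apply: memAB1; rewrite !inE eqxx orbT.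
have [cA cB1] : c \in A /\ c \notin B1 by apply: memAB1; rewrite !inE eqxx orbT.
(* Such a [z] is in both [A] and its flip [B1], hence isolated in [A]. *)
have iso z u : z \in C -> z != p -> z != b -> z != c -> u \in A -> ~~ adj z u.
  move=> zC zp zb zc; have zA : z \in A by rewrite eA in_swap zp zC.
  have : z \in B1 by rewrite eB1 eB !in_swap zb zc zC.
  by rewrite memB1 // => /forall_inP; apply.
have [bp cp cC] : [/\ b != p, c != p & c \in C].
  move: bA cA; rewrite eA !in_swap [b == a]eq_sym [c == a]eq_sym (negPf ab) (negPf ac) !orbF.
  by move=> /andP[-> _] /andP[-> ->].
have CA' z : z \in C -> z != p -> z \in A by move=> zC zp; rewrite eA in_swap zp zC.
have b'a : b' != a.
  apply: contraNneq aB1 => <-; rewrite eB1 eB !in_swap eqxx orbT andbT.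
  by apply/orP; left; apply: contraNneq b'C => ->.
have b'A : b' \notin A by rewrite eA in_swap (negPf b'C) andbF.
have c'a : c' != a by apply: contraNneq aB1 => <-; rewrite eB1 in_swap eqxx orbT.
have c'C : c' \notin C.
  apply: contra c'B => c'C; rewrite eB in_swap c'C andbT; apply/orP; left.
  by apply: contraNneq bB1 => <-; rewrite eB1 in_swap eqxx orbT.
have c'A : c' \notin A by rewrite eA in_swap (negPf c'C) andbF.
have pA : p \notin A by rewrite eA in_swap eqxx /=; apply: contraNneq aC => <-.
have pB : p \in B by rewrite eB in_swap eq_sym bp pC.
have pB1 : p \in B1 by rewrite eB1 in_swap eq_sym cp pB.
have b'B : b' \in B by rewrite eB in_swap eqxx orbT.
have b'B1 : b' \in B1 by rewrite eB1 in_swap b'B andbT; apply/orP; left; apply: contraNneq b'C => ->.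
have c'B1 : c' \in B1 by rewrite eB1 in_swap eqxx orbT.
(* Each [w] in the flip is private to some vertex of [A], which must be its only neighbour there.
   This pairs [p], [b'], [c'] with [a], [b], [c]. *)
have priv z w : z \in A -> w \in B1 -> adj z w -> {in A, forall u, u != z -> ~~ adj u w}.
  move=> zA wB1 zw; have [v vA wP] := flipB1 w wB1.
  have -> : z = v.
    apply/eqP; apply: contraLR zw => zv; case/PNP: wP => _ PNv.
    by case: (PNv z zA zv).
  by move=> u uA uv; case/PNP: wP => _ PNv; case: (PNv u uA uv).
have ap : adj a p by rewrite adjC.
have np := priv a p aA pB1 ap.
have nb' := priv b b' bA b'B1 bb'.
have nc' := priv c c' cA c'B1 cc'.
(* [b] is not isolated in [A = C - p + a] and [C] is independent, so its neighbour is [a]; likewise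
   for [c]. *)
have aba : adj b a.
  have : b \notin B1 by []; rewrite memB1 // negb_forall_in => /exists_inP[u uA].
  rewrite negbK; move: uA; rewrite eA in_swap => /orP[/andP[_ uC]|/eqP->//].
  by rewrite (negPf (indC b u bC uC)).
have aca : adj c a.
  have : c \notin B1 by []; rewrite memB1 // negb_forall_in => /exists_inP[u uA].
  rewrite negbK; move: uA; rewrite eA in_swap => /orP[/andP[_ uC]|/eqP->//].
  by rewrite (negPf (indC c u cC uC)).
have Cb' z : z \in C -> z != b -> z != p -> ~~ adj z b' by move=> zC zb zp; apply: nb'; rewrite ?CA'.
have Cc' z : z \in C -> z != c -> z != p -> ~~ adj z c' by move=> zC zc zp; apply: nc'; rewrite ?CA'.
(* Otherwise [pb'] would be the only edge inside [B]. *)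
have npb' : ~~ adj p b'.
  apply/negP => pb'; have [x [y [xB yB xp xb' xy]]] := third_nonisolated IRB pB b'B pb'.
  move: xB; rewrite eB in_swap (negPf xb') orbF => /andP[xb xC].
  move: yB xy; rewrite eB in_swap => /orP[/andP[_ yC]|/eqP->]; apply/negP; first exact: indC.
  exact: Cb'.
have nCb' z : z \in C -> z != b -> ~~ adj z b'.
  by move=> zC zb; case: (eqVneq z p) => [->//|zp]; apply: Cb'.
have indB : indep adj B.
  move=> x y; rewrite eB !in_swap.
  case/orP=> [/andP[xb xC]|/eqP->] /orP[/andP[yb yC]|/eqP->].
  - exact: indC.
  - exact: nCb'.
  - by rewrite adjC nCb'.
  - by rewrite adjI.
(* [B] is independent, so every edge inside [B1] contains [c'], and its other end can only be [p] or
   [b']. *)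
have nonisoB1 x y : x \in B1 -> y \in B1 -> adj x y -> x != c' -> adj x c' /\ (x = p \/ x = b').
  rewrite eB1 !in_swap => + + + xc'; rewrite (negPf xc') orbF => /andP[xc xB] yB1 xy.
  have xac' : adj x c'.
    by case/orP: yB1 xy => [/andP[_ yB]|/eqP->//]; rewrite (negPf (indB x y xB yB)).
  split=> //; move: xB; rewrite eB in_swap => /orP[/andP[xb xC]|/eqP]; last by right.
  by case: (eqVneq x p) => [|xp]; [left | rewrite (negPf (Cc' x xC xc xp)) in xac'].
(* [B1] is dependent, as [B] already has the independent neighbour [C]. *)
have [x [y [xB1 yB1 xy]]] : exists x y, [/\ x \in B1, y \in B1 & adj x y].
  case: (indep_or_edge B1) => [indB1|//].
  have := indep_neighbours_eq IRB IRC IRB1 indB indC indB1 (IRadj_sym IRC IRB CB) BB1.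
  by move=> eC; rewrite -eC cC in cB1.
have [z [t [zB1 tB1 zx zy zt]]] := third_nonisolated IRB1 xB1 yB1 xy.
have xNy : x != y by apply: contraTneq xy => ->; rewrite adjI.
have yx : adj y x by rewrite adjC.
(* Without this edge only [c'] and [b'] could be non-isolated in [B1], which has three such
   vertices. *)
have pc' : adj p c'.
  apply: contraTT zx => npc'.
  have sub s r : s \in B1 -> r \in B1 -> adj s r -> s = c' \/ s = b'.
    move=> sB1 rB1 sr; case: (eqVneq s c') => [|sc']; [by left | right].
    by case: (nonisoB1 s r sB1 rB1 sr sc') => + [e|//]; rewrite e (negPf npc').
  move: xNy zy; case: (sub x y xB1 yB1 xy) => ->; case: (sub y x yB1 xB1 yx) => ->;
    by case: (sub z t zB1 tB1 zt) => ->; rewrite ?eqxx.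
have b'c' : adj b' c'.
  apply: contraTT zx => nb'c'.
  have sub s r : s \in B1 -> r \in B1 -> adj s r -> s = c' \/ s = p.
    move=> sB1 rB1 sr; case: (eqVneq s c') => [|sc']; [by left | right].
    by case: (nonisoB1 s r sB1 rB1 sr sc') => + [//|e]; rewrite e (negPf nb'c').
  move: xNy zy; case: (sub x y xB1 yB1 xy) => ->; case: (sub y x yB1 xB1 yx) => ->;
    by case: (sub z t zB1 tB1 zt) => ->; rewrite ?eqxx.
have neqC w z' : w \notin C -> z' \in C -> w != z' by move=> wC; apply: contraTneq => <-.
have neqA w z' : w \notin A -> z' \in A -> w != z' by move=> wC; apply: contraTneq => <-.
(* Once [c] is removed, [c'] is private to [p]; and [b'] is private to [b]. *)
have irrA2 : irredundant adj (swap C c a).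
  apply: (@swap_irredundant C p b c a c' b') => //; first by rewrite adjC.
  - by move=> s sC sp sb sc; rewrite adjC iso.
  - apply/PNP; split; first by right.
    move=> u; rewrite in_swap => /orP[/andP[uc uC]|/eqP->] up.
      by rewrite neqC // Cc'.
    by rewrite c'a nc'.
  - apply/PNP; split; first by right.
    move=> u; rewrite in_swap => /orP[/andP[uc uC]|/eqP->] ub.
      by rewrite neqC // nCb'.
    by rewrite b'a nb'.
(* Mirror image of the previous step under the symmetry of the induced graph that exchanges [a] with
   [c'], [c] with [p] and [b] with [b']. *)
have irrB2 : irredundant adj (swap B p c').
  apply: (@swap_irredundant B c b' p c' a b) => //; first by rewrite adjC.
  - move=> s; rewrite eB in_swap => /orP[/andP[sb sC]|/eqP->]; last by rewrite eqxx.
    by move=> sc _ sp; rewrite adjC Cc'.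
  - apply/PNP; split; first by right.
    move=> u; rewrite eB !in_swap => /orP[/andP[up /orP[/andP[ub uC]|/eqP->]]|/eqP->] uc.
    + by rewrite neqC // iso.
    + by rewrite eq_sym b'a adjC nb'.
    + by rewrite eq_sym c'a adjC nc'.
  - apply/PNP; split; first by right; rewrite adjC.
    move=> u; rewrite eB !in_swap => /orP[/andP[up /orP[/andP[ub uC]|/eqP->]]|/eqP->] ub2.
    + by rewrite eq_sym ub indC.
    + by rewrite eqxx in ub2.
    + by rewrite eq_sym (neqA c' b) // adjC nc'.
have IRA2 := IRset_eq_card IRC irrA2 (card_swap cC aC).
have IRB2 := IRset_eq_card IRB irrB2 (card_swap pB c'B).
exists A, (swap C c a), B, B1, (swap B p c'); split.
- by rewrite /= IRA IRA2 IRB IRB1 IRB2.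
- have sep w (X Y : {set V}) : (w \in X) != (w \in Y) -> X != Y by apply: contraNneq => ->.
  have aB : a \notin B by rewrite eB in_swap (negPf aC) andbF eq_sym.
  have aA2 : a \in swap C c a by rewrite in_swap eqxx orbT.
  have aB2 : a \notin swap B p c' by rewrite in_swap (negPf aB) andbF eq_sym.
  have c'B2 : c' \in swap B p c' by rewrite in_swap eqxx orbT.
  have cA2 : c \notin swap C c a by rewrite in_swap eqxx eq_sym.
  have bB : b \notin B by rewrite eB in_swap eqxx /=; apply: contraNneq b'C => <-.
  have pB2 : p \notin swap B p c' by rewrite in_swap eqxx /= eq_sym; apply: contraNneq c'C => ->.
  rewrite /= !inE !negb_or !andbT.
  rewrite (sep a C A) ?(negPf aC) ?aA // (sep a C (swap C c a)) ?(negPf aC) ?aA2 //.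
  rewrite (sep b C B) ?bC ?(negPf bB) // (sep c' C B1) ?(negPf c'C) ?c'B1 //.
  rewrite (sep c' C (swap B p c')) ?(negPf c'C) ?c'B2 //.
  rewrite (sep c A (swap C c a)) ?cA ?(negPf cA2) //.
  rewrite !(sep a A) ?aA ?(negPf aB) ?(negPf aB1) ?(negPf aB2) //.
  rewrite !(sep a (swap C c a)) ?aA2 ?(negPf aB) ?(negPf aB1) ?(negPf aB2) //.
  rewrite !(sep c' B) ?c'B1 ?(negPf c'B) ?c'B2 //.
  by rewrite (sep p B1) ?pB1 ?(negPf pB2).
- by split=> //; apply: IRadj_swap => //.
- by [].
- by split=> //; apply: IRadj_swap.
Qed.
End IRsets.

(** * Trees of diameter 4 *)

Section Trees.
Variables (T : finType) (e : rel T).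
Hypotheses (eC : symmetric e) (eI : irreflexive e) (acyc : ~ has_cycle e).
Implicit Types (x y z : T) (p q : seq T).

Lemma acyclic_neq x y : e x y -> x != y.
Proof. by apply: contraTneq => ->; rewrite eI. Qed.

Lemma no_triangle x y z : e x y -> e x z -> e y z -> False.
Proof.
move=> xy xz yz; apply: acyc; exists x, [:: y; z].
by rewrite /= xy yz eC xz !inE negb_or !acyclic_neq.
Qed.

Lemma no_square w x y z : e w x -> e x y -> e w z -> e z y -> w != y -> x != z -> False.
Proof.
move=> wx xy wz zy wNy xNz; apply: acyc; exists w, [:: x; y; z].
rewrite /= wx xy (eC y) zy (eC z) wz !inE !negb_or wNy xNz !acyclic_neq //.
by rewrite eC.
Qed.

(** Where two paths diverge at [x], their next vertices [a] and [b] stay connected in the graph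
    without [x]; a simple path between them closes up through [x] to a cycle. *)
Lemma unique_path x p q : path e x p -> path e x q -> uniq (x :: p) -> uniq (x :: q) ->
  last x p = last x q -> p = q.
Proof.
elim: p x q => [|a p IHp] x [|b q] //=.
- by move=> _ _ _ /andP[xq _] xl; rewrite xl mem_last in xq.
- by move=> _ _ /andP[xp _] _ xl; rewrite -xl mem_last in xp.
move=> /andP[xa pp] /andP[xb pq] /andP[xp up] /andP[xq uq] lpq.
case: (eqVneq a b) => [ab|ab].
  by rewrite -ab in pq uq lpq *; congr (_ :: _); apply: (IHp a).
pose e' := [rel u v | [&& e u v, u != x & v != x]].
have e'C : symmetric e' by move=> u v /=; rewrite eC [(u != x) && _]andbC.
have lift s r : path e s r -> x \notin s :: r -> path e' s r.
  elim: r s => //= t r IHr s /andP[st pr]; rewrite !inE !negb_or => /and3P[xs xt xr].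
  by rewrite st eq_sym xs eq_sym xt IHr // inE negb_or xt.
have : connect e' a b.
  apply: (@connect_trans _ _ (last a p)).
    by apply/connectP; exists p; first exact: lift.
  rewrite (sym_connect_sym e'C) // lpq; apply/connectP; exists q => //; exact: lift.
case/connectP => r0 /shortenP[r pr ur _] lr.
have {pr} [pr xr] : path e a r /\ x \notin a :: r.
  have xa' : x != a by apply: acyclic_neq.
  elim: r a pr xa' {ur lr IHp xa pp xp up lpq ab r0} => [|t r IHr] a /=; first by rewrite inE.
  move=> /andP[/and3P[-> _ tx] pr] xa'.
  by have [|-> xr] := IHr t pr; rewrite 1?eq_sym // inE negb_or xa'.
case: acyc; exists x, (a :: r); split.
- by rewrite /= xa.
- by rewrite cons_uniq xr.
- by case: r lr {ur pr xr} => //= ba; rewrite ba eqxx in ab.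
- by rewrite /= -lr eC.
Qed.

(** Prefixing [q] with [t], [s] yields the unique simple path from [t] to [z]. It has at most 4
    edges, two of them before [c]. *)
Lemma bounded_branch c s t z :
  (forall x y, dist_le e x y 4) -> e c s -> e s t -> c != t ->
  (exists q, [/\ path e c q, uniq (c :: q), last c q = z & ohead q != Some s]) ->
  dist_le e c z 2.
Proof.
move=> diam cs st ct [q [pq uq lq hq]].
have [r [/shortenP[r' pr' ur' /(uniq_leq_size _) sr'] lr szr]] := diam t z.
have sizer' : size r' <= 4.
  by apply: leq_trans szr; apply: sr'; case/andP: ur'.
(* By [unique_path], a vertex of [q] that is reached from [c] through [s] would make [q] start with
   [s]. *)
have notin u pre : path e c (rcons pre u) -> uniq (c :: rcons pre u) ->
    head u (rcons pre u) = s -> u \notin q.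
  move=> ppre upre hpre; apply/negP => uqi; case/splitPr: uqi pq uq hq {lq} => q1 q2.
  rewrite -cat_rcons cat_path => /andP[pq1 _].
  rewrite -cat_cons cat_uniq => /andP[uq1 _].
  have e12 : rcons q1 u = rcons pre u by apply: (unique_path pq1 ppre uq1 upre); rewrite !last_rcons.
  by rewrite e12; case: pre hpre {ppre upre e12} => /= [|h pre] ->; rewrite eqxx.
have sq : s \notin q by apply: (notin s [::]); rewrite //= ?cs // inE andbT acyclic_neq.
have tq : t \notin q.
  by apply: (notin t [:: s]); rewrite //= ?cs ?st // !inE negb_or ct !acyclic_neq.
have er : r' = [:: s, c & q].
  apply: (@unique_path t) => //=.
  - by rewrite eC st eC cs.
  - have st' := acyclic_neq st; have cs' := acyclic_neq cs.
    move: uq; rewrite cons_uniq => /andP[cq uq]; rewrite !inE !negb_or tq sq cq uq.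
    by rewrite [t == s]eq_sym st' [t == c]eq_sym ct eq_sym cs'.
  - by rewrite lr lq.
by exists q; split=> //; rewrite er in sizer'.
Qed.

(** [c] is the middle of a path of length 4. A simple path from [c] avoids one of the two halves,
    and that half bounds its length through [bounded_branch]. *)
Lemma diameter4_centre : connected_graph e -> has_diameter e 4 ->
  exists c s1 t1 s2 t2, [/\ e c s1 /\ e s1 t1, e c s2 /\ e s2 t2, s1 != s2,
    c != t1 /\ c != t2 & forall z, dist_le e c z 2].
Proof.
move=> conn [diam [x [y far]]].
have [p0 [pp0 lp0 sp0]] := diam x y.
have [p [pp up lp sp]] :
    exists p, [/\ path e x p, uniq (x :: p), last x p = y & size p <= 4].
  case/shortenP: pp0 lp0 => p' pp' up' sub' lp'; exists p'; split=> //.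
  by apply: leq_trans sp0; apply: uniq_leq_size sub'; case/andP: up'.
have := far (size p) (ex_intro _ p (And3 pp lp (leqnn _))).
case: p pp up lp sp => [|s1 [|c [|s2 [|t2 [|]]]]] //=.
rewrite !inE !negb_or !andbT => /and4P[xs1 s1c cs2 s2y] up ey _ _.
move: up; rewrite ey => /and4P[/and4P[_ xc _ _] /and3P[_ s1s2 _] /andP[_ cy] _].
have cs1 : e c s1 by rewrite eC.
have s1x : e s1 x by rewrite eC.
rewrite ey in s2y; exists c, s1, x, s2, y; split=> //; first by rewrite eq_sym xc.
move=> z; have /connectP[q0 pq0 lq0] := conn c z.
have [q [pq uq lq]] : exists q, [/\ path e c q, uniq (c :: q) & last c q = z].
  by case/shortenP: pq0 lq0 => q pq uq _ lq; exists q.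
case: (eqVneq (ohead q) (Some s1)) => [hq|hq].
  apply: (bounded_branch diam cs2 s2y cy); exists q; split=> //.
  by rewrite hq; apply: contra s1s2 => /eqP[->].
by apply: (bounded_branch diam cs1 s1x); rewrite 1?eq_sym //; exists q.
Qed.

(** By counting, [g] is a bijection; an edge of [e] that does not come from [a] would close the
    image of a path of [a] to a cycle. *)
Lemma hom_iso (S : finType) (a : rel S) (g : S -> T) : connected_graph a ->
  injective g -> #|T| <= #|S| -> (forall i j, a i j -> e (g i) (g j)) -> isomorphic e a.
Proof.
move=> conn gI cT hom; have [h hg gh] := inj_card_bij gI cT.
exists h; split; first by exists g.
move=> x y; rewrite -{1}(gh x) -{1}(gh y); apply/idP/idP; last exact: hom.
move: (h x) (h y) => i j eij; have /connectP[p0 /shortenP[p pp up _] lp] := conn i j.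
apply: contraT => naij; case: acyc; exists (g i), (map g p); split.
- by rewrite path_map; apply: sub_path pp => u v; apply: hom.
- by rewrite -map_cons map_inj_uniq.
- case: p lp pp {up} => [|k [|l p]] //= jk; first by rewrite -jk eI in eij.
  by rewrite -jk andbT (negPf naij).
- by rewrite last_map -lp eC.
Qed.
End Trees.

(** * The double spider as an IR-graph *)

(** Turns quantifiers over ['I_n] into tests that [vm_compute] evaluates. *)
Lemma all_ordP n (P : pred nat) : reflect (forall i : 'I_n, P i) (all P (iota 0 n)).
Proof.
apply: (iffP allP) => allP i; first by apply: allP; rewrite mem_iota ltn_ord.
by rewrite mem_iota => /andP[_ lt_in]; apply: (allP (Ordinal lt_in)).
Qed.

Lemma has_ordP n (P : pred nat) : reflect (exists i : 'I_n, P i) (has P (iota 0 n)).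
Proof.
apply: (iffP hasP) => [[i]|[i Pi]]; last by exists (val i); rewrite // mem_iota ltn_ord.
by rewrite mem_iota => /andP[_ lt_in]; exists (Ordinal lt_in).
Qed.

Lemma sp_adj_sym : symmetric sp_adj.
Proof. by move=> x y; rewrite /sp_adj orbC. Qed.

Lemma sp_adj_irr : irreflexive sp_adj.
Proof. by case=> -[|[|[|[|[|[|[|//]]]]]]] lt7. Qed.

Definition ord7 k (lt7 : k < 7) : 'I_7 := Ordinal lt7.
Arguments ord7 k {lt7}.
Notation "''o_' k" := (@ord7 k isT) (at level 8, k at level 2, format "''o_' k").

Lemma sp_dist_centre x : dist_le sp_adj x 'o_3 2.
Proof.
case: x => -[|[|[|[|[|[|[|//]]]]]]] lt7.
- by exists [:: 'o_3].
- by exists [:: 'o_0; 'o_3].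
- by exists [:: 'o_0; 'o_3].
- by exists [::]; split=> //; apply: val_inj.
- by exists [:: 'o_3].
- by exists [:: 'o_3].
- by exists [:: 'o_5; 'o_3].
Qed.

Lemma sp_connected : connected_graph sp_adj.
Proof.
have toC x : connect sp_adj x 'o_3.
  by have [p [pp lp _]] := sp_dist_centre x; apply/connectP; exists p.
move=> x y; apply: connect_trans (toC x) _.
by rewrite (sym_connect_sym sp_adj_sym).
Qed.

(* The edges join each [y > 0] to a single smaller vertex, so the largest vertex of
   a cycle would have both its neighbours on the cycle equal. *)
Lemma sp_parent_unique (x y z : 'I_7) : sp_adj y x -> sp_adj y z -> x < y -> z < y -> x = z.
Proof.
move=> yx yz xy zy; apply: val_inj; move: yx yz xy zy; rewrite /sp_adj.
by case: x y z => -[|[|[|[|[|[|[|//]]]]]]] ? [[|[|[|[|[|[|[|//]]]]]]] ?] [[|[|[|[|[|[|[|//]]]]]]] ?].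
Qed.

Lemma sp_acyclic : ~ has_cycle sp_adj.
Proof.
case=> x [p [pp up sp lp]].
have cyc : cycle sp_adj (x :: p) by rewrite /= rcons_path pp.
have [m mp max] : exists2 m, m \in x :: p & {in x :: p, forall z : 'I_7, z <= m}.
  case: (@arg_maxnP 'I_7 x (mem (x :: p)) val (mem_head x p)) => m mp max.
  by exists m => // z /max.
have [i q eq] := rot_to mp.
have mem_q z : z \in m :: q -> z <= m by rewrite -eq mem_rot; apply: max.
move: cyc up sp; rewrite -(rot_cycle i) -(rot_uniq i) -ltnS -[(size p).+1]/(size (x :: p)).
rewrite -(size_rot i) eq /=.
case: q eq mem_q => [|a q] //= eq mem_q /andP[ma]; rewrite rcons_path => /andP[_ lm].
case/andP=> mq /andP[aq _] sq.
have lq : last a q \in a :: q by apply: mem_last.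
have lt_m z : z \in a :: q -> z < m.
  move=> zq; rewrite ltn_neqAle mem_q 1?inE ?zq ?orbT // andbT.
  by apply: contraNneq mq => /val_inj <-.
have ea : a = last a q.
  by apply: (@sp_parent_unique _ m); rewrite ?lt_m ?mem_head // sp_adj_sym.
by move: aq; case: q ea sq {eq mem_q mq lm lq lt_m} => //= b q -> _; rewrite mem_last.
Qed.

Lemma sp_is_tree : is_tree sp_adj.
Proof. by split; [split; [exact: sp_adj_sym | exact: sp_adj_irr] | split; [exact: sp_connected | exact: sp_acyclic]]. Qed.

Lemma sp_diameter : has_diameter sp_adj 4.
Proof.
split=> [x y|].
  have [p [pp lp sp]] := sp_dist_centre x; have [q [pq lq sq]] := sp_dist_centre y.
  exists (p ++ rev (belast y q)); split.
  - by rewrite cat_path pp lp -lq rev_path (eq_path (e' := sp_adj)) // => u v; rewrite sp_adj_sym.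
  - by rewrite last_cat lp; case: q lq {pq sq} => [/= ->//|z q _]; rewrite /= rev_cons last_rcons.
  - by rewrite size_cat size_rev size_belast (leq_add sp sq).
(* [h] is the distance to vertex 6; it drops by at most one along an edge and is 4 at vertex 1. *)
pose h (x : 'I_7) := nth 0 [:: 3; 4; 4; 2; 3; 1; 0] x.
exists 'o_1, 'o_6 => n [p [pp lp sp]]; apply: leq_trans sp.
suff : h 'o_1 <= h (last 'o_1 p) + size p by rewrite lp.
elim: p ('o_1) pp {lp} => [|y p IHp] x /=; first by rewrite addn0.
case/andP=> xy /IHp hy; rewrite addnS; apply: leq_trans (_ : (h y).+1 <= _) => //.
by move: xy; rewrite /sp_adj /h; case: x y {IHp hy} => -[|[|[|[|[|[|[|//]]]]]]] ? [[|[|[|[|[|[|[|//]]]]]]] ?].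
Qed.

(** * A seven-vertex graph whose IR-graph is the double spider *)

Definition ex_edges : seq (nat * nat) :=
  [:: (0, 1); (1, 2); (1, 3); (2, 4); (0, 5); (3, 5); (4, 5); (2, 6); (3, 6); (4, 6); (5, 6)].

Definition ex_code (i j : nat) := ((i, j) \in ex_edges) || ((j, i) \in ex_edges).
(** On [0], ..., [5], read as [c], [c'], [b'], [p], [b], [a], this is the graph forced in
    [double_star_of_centre]. Vertex [6], joined to [2], ..., [5], provides the seventh IR-set. *)
Definition ex_adj : rel 'I_7 := fun x y => ex_code x y.

Definition set_of (b : bitseq) : {set 'I_7} := [set i : 'I_7 | nth false b i].

Lemma set_ofK (D : {set 'I_7}) : exists2 b, size b = 7 & D = set_of b.
Proof.
exists (mkseq (fun i => inord i \in D) 7); first by rewrite size_mkseq.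
by apply/setP=> i; rewrite inE nth_mkseq // inord_val.
Qed.

Lemma card_set_of b : size b = 7 -> #|set_of b| = count id b.
Proof.
move=> sb; rewrite -sum1_card big_mkcond /=.
rewrite (eq_bigr (fun i : 'I_7 => nat_of_bool (nth false b i))); last by move=> i _; rewrite inE; case: nth.
rewrite -(big_mkord xpredT (fun i => nat_of_bool (nth false b i))) -sb.
rewrite -(big_nth false xpredT (fun x => nat_of_bool x)) -sum1_count [RHS]big_mkcond.
by apply: eq_bigr => -[].
Qed.

Definition PN_code v w b :=
  ((w == v) || ex_code v w) &&
  all (fun u => nth false b u && (u != v) ==> (w != u) && ~~ ex_code u w) (iota 0 7).

Definition irredundant_code b :=
  all (fun v => nth false b v ==> has (fun w => PN_code v w b) (iota 0 7)) (iota 0 7).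

Lemma PN_codeP b (v w : 'I_7) : (w \in PN ex_adj v (set_of b)) = PN_code v w b.
Proof.
apply/PNP/andP => [[wv priv]|[wv /all_ordP priv]]; split.
- by case: wv => [->|vw]; rewrite ?eqxx // -/(ex_adj v w) vw orbT.
- apply/all_ordP => u; apply/implyP => /andP[ub uv].
  by have [||-> ->] := priv u; rewrite ?inE.
- by case/orP: wv => [/eqP/val_inj|]; [left | right].
- move=> u; rewrite inE => ub uv; have := priv u.
  by rewrite ub [(u : nat) != v]uv => /andP[].
Qed.

Lemma irredundant_codeP b : irredundant ex_adj (set_of b) = irredundant_code b.
Proof.
apply/irredundantP/all_ordP => irr v.
  apply/implyP => vb; apply/has_ordP; have [|w] := irr v; first by rewrite inE.
  by rewrite PN_codeP; exists w.
rewrite inE => vb; have := irr v; rewrite vb => /has_ordP[w]; exists w.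
by rewrite PN_codeP.
Qed.

(** Listed in the numbering of [sp_adj]: the set at position [x] is the image of vertex [x]. *)
Definition ex_sets : seq bitseq :=
  [seq [seq i \in s | i <- iota 0 7] | s <-
    [:: [:: 0; 2; 3]; [:: 1; 2; 3]; [:: 0; 1; 2]; [:: 0; 3; 4];
        [:: 0; 4; 5]; [:: 3; 4; 5]; [:: 3; 5; 6]]].

Fixpoint bitseqs n : seq bitseq :=
  if n is n'.+1 then [seq b :: s | b <- [:: true; false], s <- bitseqs n'] else [:: [::]].

Lemma mem_bitseqs b : b \in bitseqs (size b).
Proof.
elim: b => // x b IHb; change (x :: b \in [seq c :: s | c <- [:: true; false], s <- bitseqs (size b)]).
by apply/allpairsP; exists (x, b); split=> //; case: x.
Qed.

(** An exhaustive check of the 128 subsets, giving at once the value 3 of [IRnum] and the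
    completeness of the list. *)
Lemma ex_sets_check :
  all (fun b => irredundant_code b ==> (count id b < 3) || (b \in ex_sets)) (bitseqs 7) &&
  all (fun b => [&& size b == 7, count id b == 3 & irredundant_code b]) ex_sets.
Proof. by vm_compute. Qed.

Lemma ex_irredundant_small b : size b = 7 -> irredundant_code b -> count id b < 3 \/ b \in ex_sets.
Proof.
move=> sb irr; have [/allP/(_ b)+ _] := andP ex_sets_check.
by rewrite -sb mem_bitseqs irr => /(_ isT)/orP.
Qed.

Lemma ex_setsP b : b \in ex_sets -> [/\ size b = 7, count id b = 3 & irredundant_code b].
Proof. by have [_ /allP sets] := andP ex_sets_check; case/sets/and3P=> /eqP ? /eqP. Qed.

Lemma ex_IRnum : IRnum ex_adj = 3.
Proof.
apply/eqP; rewrite eqn_leq; apply/andP; split.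
  apply/bigmax_leqP => D; have [b sb ->] := set_ofK D.
  rewrite irredundant_codeP card_set_of // => /(ex_irredundant_small sb)[/ltnW//|].
  by case/ex_setsP => _ ->.
have [sb cb irr] := @ex_setsP (nth [::] ex_sets 0) isT.
by rewrite /IRnum (bigmax_sup (set_of (nth [::] ex_sets 0))) ?irredundant_codeP // card_set_of // cb.
Qed.

Definition ex_set (x : 'I_7) : {set 'I_7} := set_of (nth [::] ex_sets x).

Lemma set_of_inj b b' : size b = 7 -> size b' = 7 -> set_of b = set_of b' -> b = b'.
Proof.
move=> sb sb' /setP ebb'; apply: (@eq_from_nth _ false) => [|i]; first by rewrite sb.
by rewrite sb => lt7; have := ebb' (Ordinal lt7); rewrite !inE.
Qed.

Definition swap_code b b' :=
  has (fun u => has (fun v => [&& nth false b u, nth false b' v, ex_code u v &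
    all (fun i => nth false b' i == nth false b i && (i != u) || (i == v)) (iota 0 7)])
    (iota 0 7)) (iota 0 7).

Lemma swap_codeP b b' : IRadj ex_adj (set_of b) (set_of b') <-> swap_code b b'.
Proof.
split=> [[u [v [ub vb' uv /setP eb']]]|/has_ordP[u /has_ordP[v /and4P[ub vb' uv /all_ordP eb']]]].
  apply/has_ordP; exists u; apply/has_ordP; exists v.
  rewrite !inE in ub vb'; rewrite ub vb' -/(ex_adj u v) uv; apply/all_ordP => i.
  by have := eb' i; rewrite !inE => ->; rewrite andbC.
exists u, v; split; rewrite ?inE //; apply/setP=> i.
by rewrite !inE (eqP (eb' i)) andbC.
Qed.

Lemma sp_IR_graph : IR_graph sp_adj.
Proof.
have in_sets (x : 'I_7) : nth [::] ex_sets x \in ex_sets by rewrite mem_nth //; apply: ltn_ord.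
exists 'I_7, ex_adj; split.
  by split=> [x y|]; [rewrite /ex_adj /ex_code orbC | case=> -[|[|[|[|[|[|[|//]]]]]]] lt7].
exists ex_set; split.
- move=> x y /set_of_inj exy; apply/val_inj/eqP.
  have [[sx _ _] [sy _ _]] := (ex_setsP (in_sets x), ex_setsP (in_sets y)).
  by rewrite -(@nth_uniq _ [::] ex_sets) ?ltn_ord // exy.
- move=> D; have [b sb ->] := set_ofK D.
  rewrite /IRset irredundant_codeP card_set_of // ex_IRnum; split=> [/andP[irr /eqP cb]|[x]].
    have [|/(nthP [::])[i lt7 <-]] := ex_irredundant_small sb irr; first by rewrite cb.
    by exists (Ordinal (lt7 : i < 7)).
  have [sx cx irrx] := ex_setsP (in_sets x).
  by move/(set_of_inj sx sb) <-; rewrite irrx cx.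
- move=> x y; apply: iff_trans (iff_sym (swap_codeP _ _)).
  have : all (fun i => all (fun j => ((i, j) \in sp_edges) || ((j, i) \in sp_edges)
    == swap_code (nth [::] ex_sets i) (nth [::] ex_sets j)) (iota 0 7)) (iota 0 7) by vm_compute.
  by move/all_ordP/(_ x)/all_ordP/(_ y)/eqP; rewrite -/(sp_adj x y) => ->.
Qed.

(** * Uniqueness *)

(** The double star fills six vertices. The centre [c] also starts a branch [s], [t] away from [b];
    its end [t] is the seventh vertex, so [s] is a leaf of the double star at [c]. *)
Lemma IR_tree_diameter4_unique (T : finType) (e : rel T) :
  is_tree e -> has_diameter e 4 -> #|T| <= 7 -> IR_graph e -> isomorphic e sp_adj.
Proof.
move=> [[eC eI] [conn acyc]] diam cT [V [adj [[adjC adjI] [f [fI fIR fadj]]]]].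
have IRf x : IRset adj (f x) by apply/fIR; exists x.
have fE D : IRset adj D -> exists x, f x = D by case: (fIR D).
have efI x y : IRadj adj (f x) (f y) -> e x y by case: (fadj x y).
have noTri (X Y Z : {set V}) : IRset adj X -> IRset adj Y -> IRset adj Z ->
    IRadj adj X Y -> IRadj adj X Z -> IRadj adj Y Z -> False.
  move=> /fE[x <-] /fE[y <-] /fE[z <-] /efI xy /efI xz /efI yz.
  exact: (no_triangle eC eI acyc xy xz yz).
have noSq (W X Y Z : {set V}) : IRset adj W -> IRset adj X -> IRset adj Y -> IRset adj Z ->
    IRadj adj W X -> IRadj adj X Y -> IRadj adj W Z -> IRadj adj Z Y -> W != Y -> X != Z -> False.
  move=> /fE[w <-] /fE[x <-] /fE[y <-] /fE[z <-] /efI wx /efI xy /efI wz /efI zy.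
  rewrite !(inj_eq fI); exact: (no_square eC eI acyc wx xy wz zy).
have [c [s1 [t1 [s2 [t2 [[cs1 st1] [cs2 st2] s12 [ct1 ct2] ecc]]]]]] :=
  diameter4_centre eC eI acyc conn diam.
have [||A1 [A2 [B [B1 [B2 []]]]]] := double_star_of_centre adjC adjI noTri noSq (IRf c) (IRf s1)
  (IRf s2) (proj1 (fadj c s1) cs1) (proj1 (fadj c s2) cs2).
- by rewrite (inj_eq fI).
- move=> X /fE[x <-]; have [p [pp <- sp]] := ecc x.
  case: p pp sp => [|y [|z [|//]]] /=; first by constructor 1.
    by rewrite andbT => /fadj cy _; constructor 2.
  by case/and3P=> /fadj cy /fadj yz _ _; constructor 3; exists (f y).
move=> IRs unF; case/and5P: IRs unF => /fE[a1 <-] /fE[a2 <-] /fE[b <-] /fE[b1 <-] /andP[/fE[b2 <-] _] unF.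
have {unF} unL : uniq [:: c; a1; a2; b; b1; b2] by rewrite -(map_inj_uniq fI).
move=> [/efI ca1 /efI ca2] /efI cb [/efI bb1 /efI bb2].
have [s [t [cs st ct sb]]] : exists s t, [/\ e c s, e s t, c != t & s != b].
  case: (eqVneq s1 b) => [e1|s1b]; last by exists s1, t1.
  by exists s2, t2; split=> //; rewrite -e1 eq_sym.
have tri := no_triangle eC eI acyc.
have ts : t != s by rewrite eq_sym (acyclic_neq eI st).
have bs : b != s by rewrite eq_sym.
have bc : e b c by rewrite eC.
have sc : e s c by rewrite eC.
have ts' : e t s by rewrite eC.
(* If [t] were a neighbour of [c], there would be a triangle on [c], [s], [t]; if it were [b1] or
   [b2], a 4-cycle through [c], [b], [t], [s]. *)
have notL u : u \in [:: c; a1; a2; b; b1; b2] -> t != u.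
  rewrite !inE; do ![case/orP]; move=> /eqP->; rewrite ?[t == _]eq_sym //; apply: contraT; rewrite negbK => /eqP ut.
  - by case: (tri c s t) => //; rewrite -ut.
  - by case: (tri c s t) => //; rewrite -ut.
  - by case: (tri c s t) => //; rewrite -ut.
  - by case: (@no_square _ _ eC eI acyc c b b1 s) => //; [rewrite ut | move: unL; rewrite ut].
  - by case: (@no_square _ _ eC eI acyc c b b2 s) => //; [rewrite ut | move: unL; rewrite ut].
have tL : t \notin [:: c; a1; a2; b; b1; b2] by apply/negP => /notL; rewrite eqxx.
have csN : c != s by rewrite (acyclic_neq eI cs).
have sB u : e b u -> s != u.
  by move=> bu; apply: contraTneq cs => ->; apply/negP => cu; apply: (tri _ _ _ cb cu bu).
have uniqL : uniq [:: t, s & [:: c; a1; a2; b; b1; b2]] -> False.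
  by move=> /card_uniqP card8; have := leq_trans (max_card (mem [:: t; s; c; a1; a2; b; b1; b2])) cT; rewrite card8.
(* Otherwise [s] and [t] would bring the number of vertices to eight. *)
have {}uniqL : s \in [:: a1; a2].
  apply: contraT => sNa; case: uniqL.
  rewrite cons_uniq inE negb_or ts tL cons_uniq unL andbT /=.
  move: sNa; rewrite !inE !negb_or => /andP[-> ->].
  by rewrite eq_sym csN sb !sB.
have utL : uniq [:: t; c; a1; a2; b; b1; b2] by rewrite cons_uniq tL.
have a12 : a1 != a2 by move: unL; rewrite /= !inE !negb_or => /and3P[_ /andP[]].
have [o [co uL]] : exists o, e c o /\ uniq [:: b; b1; b2; c; o; s; t].
  move: uniqL; rewrite !inE => /orP[]/eqP->; [exists a2 | exists a1]; split=> //.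
    rewrite (perm_uniq (s2 := [:: t; c; a1; a2; b; b1; b2])); first exact: utL.
    by apply/permP => P /=; ring.
  rewrite (perm_uniq (s2 := [:: t; c; a1; a2; b; b1; b2])); first exact: utL.
  by apply/permP => P /=; ring.
(* The list follows the numbering of [sp_adj]: [b] is vertex 0, [c] is vertex 3 and [s] is the
   subdividing vertex 5. *)
pose g (i : 'I_7) := nth c [:: b; b1; b2; c; o; s; t] i.
apply: (@hom_iso _ _ eC eI acyc _ sp_adj g sp_connected) => //.
- by move=> i j /eqP; rewrite nth_uniq ?ltn_ord // => /eqP/val_inj.
- by rewrite card_ord.
- by case=> -[|[|[|[|[|[|[|//]]]]]]] ? [[|[|[|[|[|[|[|//]]]]]]] ?] //= _; rewrite /g //= eC.
Qed.

Theorem theorem5p5 :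
  [/\ is_tree sp_adj, #|'I_7| = 7, has_diameter sp_adj 4 & IR_graph sp_adj] /\
  forall (T : finType) (e : rel T),
    is_tree e -> has_diameter e 4 -> #|T| <= 7 -> IR_graph e ->
    isomorphic e sp_adj.
Proof.
split; last exact: IR_tree_diameter4_unique.
split; [exact: sp_is_tree | exact: card_ord | exact: sp_diameter | exact: sp_IR_graph].
Qed.
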